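(* For all integers $r\geq 1$, the Jones polynomial of the knot $K_r$ satisfies $V(K_r)\equiv 1 \mod 2^r$. Moreover, the leading term of $\chi(K_r)$ is equal to $\ell_r$, where $\ell_r$ denotes the leading term of $f(M_r)$.
   Context: Tangles. A tangle is a tangle diagram in a disc with four boundary endpoints NW, NE, SW, SE. $T_1+T_2$ (horizontal sum) places $T_1$ to the left of $T_2$, joining the NE and SE endpoints of $T_1$ to the NW and SW endpoints of $T_2$ respectively. $T_1\ast T_2$ (vertical sum) places $T_1$ above $T_2$, joining the SW and SE endpoints of $T_1$ to the NW and NE endpoints of $T_2$ respectively. The tangle $0$ consists of two disjoint arcs joining NW to NE and SW to SE; the tangle $\infty$ consists of two disjoint arcs joining NW to SW and NE to SE. The tangle $1$ is a single crossing whose overstrand joins NW to SE and whose understrand joins SW to NE; the tangle $-1$ is a single crossing whose overstrand joins SW to NE and whose understrand joins NW to SE. For a tangle $T$, $-T$ is obtained from $T$ by switching all crossings. For a positive integer $k$: $k=1+\cdots+1$, $-k=(-1)+\cdots+(-1)$, $1/k=1\ast\cdots\ast 1$ and $-1/k=(-1)\ast\cdots\ast(-1)$, with $k$ terms each. $\mathrm{den}(T)$ is the link diagram obtained from $T$ by joining (outside the disc) NW to SW and NE to SE. Define $T_{10}=((((1/2)+1)\ast 2)+(-3))\ast 2$, $T_{20}=T_{10}+(-T_{10})$, $M_1=T_{20}$ and $M_r=M_{r-1}+M_{r-1}$ for $r\geq 2$. For $r\ge 1$, $K_r$ is the knot represented by the diagram $\mathrm{den}(1\ast M_r)$ (this diagram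 has exactly one component). Kauffman bracket. Let $\Lambda=\mathbb{Z}[t,t^{-1}]$ and $\delta=-t^{-2}-t^2$. The Kauffman bracket of link diagrams and of tangles is computed by the rules: $\langle \bigcirc\rangle=1$ for a single crossingless circle; $\langle\bigcirc\amalg T\rangle=\delta\langle T\rangle$; and, locally at a crossing, $\langle -1\rangle=t^{-1}\langle 0\rangle+t\langle\infty\rangle$ (hence $\langle 1\rangle=t\langle 0\rangle+t^{-1}\langle\infty\rangle$). For a tangle $T$ this yields a unique expression $\langle T\rangle=f(T)\langle 0\rangle+g(T)\langle\infty\rangle$ with $f(T),g(T)\in\Lambda$. The writhe $\mathrm{wr}(D)$ of an oriented link diagram $D$ is the sum of the signs of its crossings; with both strands directed from left to right, a crossing has sign $+1$ if the overstrand goes from NW to SE and $-1$ if the overstrand goes from SW to NE. For a link $L$ with oriented diagram $D$, $\chi(L)=(-t^3)^{-\mathrm{wr}(D)}\langle D\rangle$ is the normalized Kauffman bracket polynomial (an invariant of $L$), and the Jones polynomial is $V(L)=\chi(L)|_{t\leftarrow t^{-1/4}}$. For $f,g\in\mathbb{Z}[t,t^{-1}]$ and an integer $m\ge2$, $f\equiv g\mod m$ means $f-g\in m\,\mathbb{Z}[t,t^{-1}]$. The leading term of a nonzero Laurent polynomial is its term of highest degree in $t$ (coefficient included). *)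

(* Defs.v *)
From HB Require Import structures.
From mathcomp Require Import all_boot all_order all_algebra.

Set Implicit Arguments.
Unset Strict Implicit.
Unset Printing Implicit Defensive.

Import GRing.Theory.
Local Open Scope ring_scope.

(* Tangle diagrams built from elementary ones by the two sums.  [cross true]
   is the tangle 1 (overstrand NW-SE), [cross false] is the tangle -1
   (overstrand SW-NE). *)
Inductive tangle :=
  | zero
  | infty
  | cross of bool
  | hsum of tangle & tangle
  | vsum of tangle & tangle.

Declare Scope tangle_scope.
Delimit Scope tangle_scope with T.
Bind Scope tangle_scope with tangle.
Notation "A + B" := (hsum A B) : tangle_scope.
Notation "A * B" := (vsum A B) : tangle_scope.

Fixpoint mirror (T : tangle) : tangle :=
  match T with
  | zero => zero
  | infty => infty
  | cross b => cross (~~ b)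
  | hsum A B => mirror A + mirror B
  | vsum A B => mirror A * mirror B
  end%T.
Notation "- A" := (mirror A) : tangle_scope.

(* k terms, for k >= 1 *)
Definition hrep (T : tangle) (k : nat) : tangle :=
  iter k.-1 (fun S => S + T)%T T.
Definition vrep (T : tangle) (k : nat) : tangle :=
  iter k.-1 (fun S => S * T)%T T.

(* A corner of a disc: the first boolean says "north", the second "west",
   so NW = (true, true), NE = (true, false), SW = (false, true) and
   SE = (false, false). *)
Definition corner : finType := (bool * bool)%type.

(* The corners of all the elementary discs of T. *)
Fixpoint point (T : tangle) : finType :=
  match T with
  | hsum A B | vsum A B => (point A + point B)%type
  | _ => corner
  end.

(* The endpoint of T at a given corner. *)
Fixpoint at_corner (T : tangle) : corner -> point T :=
  match T return corner -> point T with
  | hsum A B => fun c => if c.2 then inl (at_corner A c) else inr (at_corner B c)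
  | vsum A B => fun c => if c.1 then inl (at_corner A c) else inr (at_corner B c)
  | _ => id
  end.

(* Two points are the ends of one strand inside an elementary disc. *)
Fixpoint strand (T : tangle) : rel (point T) :=
  match T return rel (point T) with
  | zero => fun p q => (p.1 == q.1) && (p.2 != q.2)
  | infty => fun p q => (p.1 != q.1) && (p.2 == q.2)
  | cross _ => fun p q => (p.1 != q.1) && (p.2 != q.2)
  | hsum A B | vsum A B => fun p q =>
      match p, q with
      | inl p, inl q => strand p q
      | inr p, inr q => strand p q
      | _, _ => false
      end
  end.

Definition glued_h (A B : tangle) (p : point A) (q : point B) : bool :=
  [exists n : bool,
    (p == at_corner A (n, false)) && (q == at_corner B (n, true))].
Definition glued_v (A B : tangle) (p : point A) (q : point B) : bool :=
  [exists w : bool,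
    (p == at_corner A (false, w)) && (q == at_corner B (true, w))].

(* Two points are joined to each other by one of the sums occurring in T. *)
Fixpoint join (T : tangle) : rel (point T) :=
  match T return rel (point T) with
  | hsum A B => fun p q =>
      match p, q with
      | inl p, inl q => join p q
      | inr p, inr q => join p q
      | inl p, inr q | inr q, inl p => glued_h p q
      end
  | vsum A B => fun p q =>
      match p, q with
      | inl p, inl q => join p q
      | inr p, inr q => join p q
      | inl p, inr q | inr q, inl p => glued_v p q
      end
  | _ => fun _ _ => false
  end.

Definition curve (T : tangle) : rel (point T) :=
  fun p q => strand p q || join p q.

Variant link_diagram := den of tangle.

Definition interior (D : link_diagram) : tangle := let: den T := D in T.

Definition lpoint (D : link_diagram) : finType := point (interior D).

Definition closure_arc (T : tangle) : rel (point T) :=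
  fun p q => [exists c : corner,
    (p == at_corner T c) && (q == at_corner T (~~ c.1, c.2))].

(* The link diagram D as a graph: each point has one strand on one side and
   one gluing or closing arc on the other side, so the connected components
   are the components of D. *)
Definition lcurve (D : link_diagram) : rel (lpoint D) :=
  fun p q => curve p q || closure_arc p q.

(* An orientation of D: [o p] says that the strand ending at p is directed
   from p into its elementary disc.  Direction is propagated along strands and
   across gluings exactly when neighbouring points have opposite values. *)
Definition orientation (D : link_diagram) (o : lpoint D -> bool) : Prop :=
  forall p q : lpoint D, lcurve p q -> o p != o q.

(* The strands of a crossing are both directed from left to right, or both
   from right to left, iff its NW and SW corners have the same value;
   otherwise, exactly one of them is reversed, which changes the sign. *)
Fixpoint writhe_rec (T : tangle) : (point T -> bool) -> int :=
  match T return (point T -> bool) -> int with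
  | zero | infty => fun _ => 0
  | cross b => fun o =>
      if (o (true, true) == o (false, true)) == b then 1 else -1
  | hsum A B | vsum A B => fun o =>
      writhe_rec (fun p : point A => o (inl p)) +
      writhe_rec (fun q : point B => o (inr q))
  end.

Definition writhe (D : link_diagram) (o : lpoint D -> bool) : int :=
  writhe_rec o.

(* Orientations of link diagrams always exist.  The proof shows that one can
   prescribe the directions at the four endpoints of a tangle, provided that
   they are opposite at the two ends of each of its arcs; [m] is the difference
   between the two ends of an arc. *)
Definition opposite (m : corner) (b : corner -> bool) : Prop :=
  forall c, b (c.1 (+) m.1, c.2 (+) m.2) = ~~ b c.

Definition orientable_as (T : tangle) (b : corner -> bool) : Prop :=
  exists2 o : point T -> bool,
    forall p q, curve p q -> o p != o q & forall c, o (at_corner T c) = b c.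

Lemma hsum_opposite (m n : corner) :
    m != (false, false) -> n != (false, false) ->
  exists2 k : corner, k != (false, false) &
    forall b, opposite k b -> exists x y : bool,
      opposite m (fun c => if c.1 then if c.2 then b (true, true) else x
                           else if c.2 then b (false, true) else y) /\
      opposite n (fun c => if c.1 then if c.2 then ~~ x else b (true, false)
                           else if c.2 then ~~ y else b (false, false)).
Proof.
move=> mP nP; exists (if (m == (true, false)) || (n == (true, false))
                      then (true, false) else (m.1 (+) n.1, true)).
  by case: m n mP nP => [[] []] [[] []].
move=> b bP; have := bP (true, true); have := bP (true, false).
have := bP (false, false).
case: m n mP nP {bP} => [[] []] [[] []] //= _ _;
  case: (b (true, true)); case: (b (true, false));
  case: (b (false, true)); case: (b (false, false)) => //= _ _ _;
  first [ by exists true, true; split; case=> [[] []]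
        | by exists true, false; split; case=> [[] []]
        | by exists false, true; split; case=> [[] []]
        | by exists false, false; split; case=> [[] []] ].
Qed.

Lemma vsum_opposite (m n : corner) :
    m != (false, false) -> n != (false, false) ->
  exists2 k : corner, k != (false, false) &
    forall b, opposite k b -> exists x y : bool,
      opposite m (fun c => if c.1 then if c.2 then b (true, true)
                                       else b (true, false)
                           else if c.2 then x else y) /\
      opposite n (fun c => if c.1 then if c.2 then ~~ x else ~~ y
                           else if c.2 then b (false, true)
                                else b (false, false)).
Proof.
move=> mP nP; exists (if (m == (false, true)) || (n == (false, true))
                      then (false, true) else (true, m.2 (+) n.2)).
  by case: m n mP nP => [[] []] [[] []].
move=> b bP; have := bP (true, true); have := bP (true, false).
have := bP (false, false).
case: m n mP nP {bP} => [[] []] [[] []] //= _ _;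
  case: (b (true, true)); case: (b (true, false));
  case: (b (false, true)); case: (b (false, false)) => //= _ _ _;
  first [ by exists true, true; split; case=> [[] []]
        | by exists true, false; split; case=> [[] []]
        | by exists false, true; split; case=> [[] []]
        | by exists false, false; split; case=> [[] []] ].
Qed.

Lemma tangle_orientable (T : tangle) :
  exists2 m : corner, m != (false, false) &
    forall b, opposite m b -> orientable_as T b.
Proof.
elim: T => [||e|A [m mP IHA] B [n nP IHB]|A [m mP IHA] B [n nP IHB]].
- exists (false, true) => // b bP; exists b => // -[p1 p2] [q1 q2].
  rewrite /curve /= orbF => /andP[/eqP <-]; have := bP (p1, p2).
  by case: p1 p2 q2 {bP} => [] [] [] //= ->; case: (b _).
- exists (true, false) => // b bP; exists b => // -[p1 p2] [q1 q2].
  rewrite /curve /= orbF => /andP[]; have := bP (p1, p2).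
  by case: p1 p2 q1 q2 {bP} => [] [] [] [] //= ->; case: (b _).
- exists (true, true) => // b bP; exists b => // -[p1 p2] [q1 q2].
  rewrite /curve /= orbF => /andP[]; have := bP (p1, p2).
  by case: p1 p2 q1 q2 {bP} => [] [] [] [] //= ->; case: (b _).
- have [k kP bP] := hsum_opposite mP nP; exists k => // b /bP[x [y [bA bB]]].
  have [oA oAP oAb] := IHA _ bA; have [oB oBP oBb] := IHB _ bB.
  exists (fun p : point (A + B)%T =>
            match p with inl p => oA p | inr q => oB q end).
    have gl (p : point A) (q : point B) : glued_h p q -> oA p != oB q.
      move=> /existsP[d /andP[/eqP-> /eqP->]]; rewrite oAb oBb /=.
      by case: d; [case: (x)|case: (y)].
    case=> [p|p] [q|q]; rewrite /curve /=; [exact: oAP|exact: gl| |exact: oBP].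
    by rewrite eq_sym; apply: gl.
  by case=> [[] []] /=; rewrite ?oAb ?oBb.
- have [k kP bP] := vsum_opposite mP nP; exists k => // b /bP[x [y [bA bB]]].
  have [oA oAP oAb] := IHA _ bA; have [oB oBP oBb] := IHB _ bB.
  exists (fun p : point (A * B)%T =>
            match p with inl p => oA p | inr q => oB q end).
    have gl (p : point A) (q : point B) : glued_v p q -> oA p != oB q.
      move=> /existsP[d /andP[/eqP-> /eqP->]]; rewrite oAb oBb /=.
      by case: d; [case: (x)|case: (y)].
    case=> [p|p] [q|q]; rewrite /curve /=; [exact: oAP|exact: gl| |exact: oBP].
    by rewrite eq_sym; apply: gl.
  by case=> [[] []] /=; rewrite ?oAb ?oBb.
Qed.

Lemma orientation_exists (D : link_diagram) : exists o, @orientation D o.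
Proof.
case: D => T; have [m mP bP] := tangle_orientable T.
have [b bm bv] : exists2 b, opposite m b & forall c : corner,
    b c != b (~~ c.1, c.2).
  exists (fun c => if m.1 && m.2 then c.1 else c.1 (+) (m.2 && c.2)).
    by case: m mP {bP} => [[] []] // _ [[] []].
  by case: m mP {bP} => [[] []] // _ [[] []].
have [o oP ob] := bP b bm; exists o => p q /orP[/oP //|].
by move=> /existsP[c /andP[/eqP-> /eqP->]]; rewrite !ob.
Qed.

(* The crossingless tangles obtained from T by applying the skein rule
   <1> = t <0> + t^-1 <oo>, <-1> = t^-1 <0> + t <oo> at each crossing, each
   with its exponent of t. *)
Fixpoint states (T : tangle) : seq (int * tangle) :=
  match T with
  | zero | infty => [:: (0, T)]
  | cross b => let e : int := if b then 1 else -1 in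
               [:: (e, zero); (- e, infty)]
  | hsum A B =>
      [seq (x.1 + y.1, (x.2 + y.2)%T) | x <- states A, y <- states B]
  | vsum A B =>
      [seq (x.1 + y.1, (x.2 * y.2)%T) | x <- states A, y <- states B]
  end.

(* For crossingless S: the closed circles of S, i.e. the components that do
   not reach the boundary of the disc. *)
Definition closed_circles (S : tangle) : nat :=
  n_comp (@curve S)
    [pred p | ~~ [exists c : corner, connect (@curve S) p (at_corner S c)]].

(* For crossingless D: the number of circles. *)
Definition circles (D : link_diagram) : nat := n_comp (@lcurve D) predT.

(* All the Laurent polynomials below are seen in the field of fractions
   Q(t) of Z[t]. *)
Definition ratfun : fieldType := {fraction {poly int}}.

Definition t : ratfun := FracField.tofrac ('X : {poly int}).

Definition delta : ratfun := - t ^ (-2) - t ^ 2.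

(* The coefficients of <0> and of <oo> in the bracket of a tangle. *)
Definition f_coef (T : tangle) : ratfun :=
  \sum_(s <- states T |
      connect (@curve s.2) (at_corner s.2 (true, true))
                           (at_corner s.2 (true, false)))
    t ^ s.1 * delta ^+ closed_circles s.2.
Definition g_coef (T : tangle) : ratfun :=
  \sum_(s <- states T |
      connect (@curve s.2) (at_corner s.2 (true, true))
                           (at_corner s.2 (false, true)))
    t ^ s.1 * delta ^+ closed_circles s.2.

(* The bracket of a link diagram; n circles have bracket delta^(n-1). *)
Definition bracket (D : link_diagram) : ratfun :=
  \sum_(s <- states (interior D)) t ^ s.1 * delta ^+ (circles (den s.2)).-1.

Definition chi (D : link_diagram) (o : lpoint D -> bool) : ratfun :=
  (- t ^+ 3) ^ (- writhe o) * bracket D.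

(* Substitution of v for the variable in h; meaningful when the denominator
   of h does not vanish at v. *)
Definition subst (v h : ratfun) : ratfun :=
  (map_poly intr (frac (repr h)).1).[v] / (map_poly intr (frac (repr h)).2).[v].

(* The Jones polynomial, an element of Z[t^(1/4), t^(-1/4)], as a rational
   function of t^(1/4): it is t^(1/4) which is represented by the generator of
   [ratfun], hence t by its fourth power. *)
Definition jones (D : link_diagram) (o : lpoint D -> bool) : ratfun :=
  subst t^-1 (chi o).

(* h is a Laurent polynomial in v with integer coefficients. *)
Definition laurent (v h : ratfun) : Prop :=
  exists (p : {poly int}) (n : nat), h = (map_poly intr p).[v] / v ^+ n.

Definition laurent_congr (v : ratfun) (m : nat) (f g : ratfun) : Prop :=
  [/\ laurent v f, laurent v g & exists2 h, laurent v h & f - g = m%:R * h].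

(* l is the leading term (with its coefficient) of the nonzero Laurent
   polynomial h in t. *)
Definition leading_term (h l : ratfun) : Prop :=
  exists (p : {poly int}) (n : nat),
    [/\ p != 0, h = FracField.tofrac p / t ^+ n &
        l = (lead_coef p)%:~R * t ^ ((size p).-1%:Z - n%:Z)].

Definition T10 : tangle :=
  ((((vrep (cross true) 2 + cross true) * hrep (cross true) 2)
    + hrep (cross false) 3) * hrep (cross true) 2)%T.

Definition T20 : tangle := (T10 + - T10)%T.

(* Meant for r >= 1. *)
Definition M (r : nat) : tangle := iter r.-1 (fun S => S + S)%T T20.

Definition K (r : nat) : link_diagram := den (cross true * M r)%T.

(* Main.v *)
From HB Require Import structures.
Require Import Defs.
From mathcomp Require Import all_boot all_order all_algebra.
From mathcomp Require Import zify ring.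
Import GRing.Theory.
Local Open Scope ring_scope.

(** The bracket of a tangle built from crossings by the two sums depends only
    on the pair of its coefficients at 0 and at infinity, and this pair obeys
    a bilinear rule for each sum ([skein], [skein_coef]).  The rule comes from
    counting circles: a crossingless tangle joins its endpoints like 0 or like
    infinity, gluing two of them adds two edges to the disjoint union of two
    graphs, and an edge lowers the number of components by one unless its ends
    are already connected ([n_comp_add_edge], [boundary_type_hsum],
    [boundary_type_vsum], [circles_den]).

    Put u = t^4.  Running the rules on T20 gives f = p(u) / u^7 and
    g = t^2 q(u) / u^7 with integer polynomials such that p = u^7 mod 2,
    q = 0 mod 2 and deg q < deg p ([skein_T20]).  Doubling M = S + S replaces
    (p, q, n) by (p^2, q (2 p - (1 + u) q), 2 n): both congruences gain a
    factor 2 and the inequality of degrees is preserved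
    ([skein_invariant_double]), so that f(M_r) is congruent to 1 and g(M_r) to
    0 modulo 2^r ([skein_M]).

    Closing 1 * M_r gives the bracket - t^3 f(M_r) - t^-3 g(M_r), and the
    writhe is 1: the contributions of T10 and of its mirror image cancel, and
    the strands of the extra crossing are directed in parallel whatever the
    orientation ([writhe_K]).  Hence
    chi(K_r) = f(M_r) + t^-6 g(M_r) = (u p(u) + q(u)) / u^(n+1) ([chi_K]).
    This is a Laurent polynomial in u congruent to 1 modulo 2^r, whose leading
    term is that of p(u) / u^n as deg q < deg p; replacing t by its inverse
    preserves the congruence ([subst_tV]). *)

Set Implicit Arguments.
Unset Strict Implicit.
Unset Printing Implicit Defensive.

(** * Components of finite graphs *)

Section Graphs.

Local Open Scope nat_scope.

Definition add_edge (T : finType) (e : rel T) (x y : T) : rel T :=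
  fun p q => [|| e p q, (p == x) && (q == y) | (p == y) && (q == x)].

Lemma add_edge_sym (T : finType) (e : rel T) (x y : T) :
  symmetric e -> symmetric (add_edge e x y).
Proof.
by move=> sym_e p q; rewrite /add_edge sym_e; case: (e q p) => //=;
   rewrite orbC !(andbC (q == _)).
Qed.

Lemma connect_add_edge (T : finType) (e : rel T) (x y : T) :
    symmetric e -> forall p q,
  connect (add_edge e x y) p q =
  [|| connect e p q, connect e p x && connect e y q
    | connect e p y && connect e x q].
Proof.
move=> /sym_connect_sym sym_e p q.
have sub_e : subrel (connect e) (connect (add_edge e x y)).
  by apply: connect_sub => a b ab; apply: connect1; rewrite /add_edge ab.
have xy : connect (add_edge e x y) x y.
  by apply: connect1; rewrite /add_edge !eqxx orbT.
have yx : connect (add_edge e x y) y x.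
  by apply: connect1; rewrite /add_edge !eqxx !orbT.
apply/idP/idP; last first.
  case/or3P=> [|/andP[px yq]|/andP[py xq]]; first exact: sub_e.
    exact: connect_trans (sub_e _ _ px) (connect_trans xy (sub_e _ _ yq)).
  exact: connect_trans (sub_e _ _ py) (connect_trans yx (sub_e _ _ xq)).
case/connectP=> s; elim: s p => /= [|z s IHs] p.
  by move=> _ ->; rewrite connect0.
case/andP=> pz /IHs{}IHs /IHs{IHs}.
case/or3P: pz => [/connect1 pz|/andP[/eqP-> /eqP->]|/andP[/eqP-> /eqP->]].
- by rewrite !(same_connect sym_e pz).
- by rewrite !connect0; case: (connect e y q); case: (connect e x q);
     rewrite ?orbT ?andbF.
- by rewrite !connect0; case: (connect e y q); case: (connect e x q);
     rewrite ?orbT ?andbF.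
Qed.

(** If x and y are not connected, the union of their classes consists of two
    components before the edge is added and of one after; away from it the
    classes, hence their chosen representatives, do not change. *)
Lemma n_comp_add_edge (T : finType) (e : rel T) (x y : T) :
    symmetric e ->
  n_comp e predT = n_comp (add_edge e x y) predT + ~~ connect e x y.
Proof.
move=> sym; have sym_e := sym_connect_sym sym.
have sym_e' := sym_connect_sym (add_edge_sym x y sym).
have conn := connect_add_edge x y sym.
case: (boolP (connect e x y)) => [xy|nxy] /=.
  rewrite addn0; apply: eq_n_comp => p q; rewrite conn.
  have [//|npq] := boolP (connect e p q).
  rewrite -(same_connect_r sym_e xy p) -(same_connect sym_e xy q).
  case: (boolP (connect e p x)) npq => //= px.
  by rewrite (same_connect sym_e px) => /negPf->.
pose a := closure e (pred2 x y).
have aE p : (p \in a) = connect e p x || connect e p y.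
  apply/idP/orP => [/pred0Pn[z /andP[/= pz /pred2P[<-|<-]]]|];
    [by left|by right|].
  by move=> pz; apply/existsP; case: pz => pz; [exists x|exists y];
    rewrite !inE pz eqxx ?orbT.
have aE' p : (p \in a) = connect (add_edge e x y) x p.
  rewrite aE conn connect0 /= (negPf nxy) orbF; congr (_ || _); exact: sym_e.
rewrite (n_compC a) (n_compC a (add_edge e x y)).
rewrite (n_comp_closure2 sym_e) nxy (eq_n_comp_r aE') (n_comp_connect sym_e').
suff -> : n_comp e [predC a] = n_comp (add_edge e x y) [predC a].
  by rewrite addnAC.
apply: eq_card => p; rewrite !inE; case: (boolP (p \in a)); rewrite ?andbF //.
rewrite !andbT aE negb_or => /andP[npx npy]; rewrite /roots /fingraph.root.
have eq_p : connect e p =1 connect (add_edge e x y) p; last first.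
  by rewrite (eq_pick eq_p).
by move=> q; rewrite conn (negPf npx) (negPf npy) orbF.
Qed.

Definition sum_rel (T1 T2 : finType) (e1 : rel T1) (e2 : rel T2) :
    rel (T1 + T2)%type :=
  fun p q => match p, q with
             | inl p, inl q => e1 p q
             | inr p, inr q => e2 p q
             | _, _ => false
             end.

Section SumRel.

Variables (T1 T2 : finType) (e1 : rel T1) (e2 : rel T2).
Hypotheses (sym1 : symmetric e1) (sym2 : symmetric e2).

Lemma sum_rel_sym : symmetric (sum_rel e1 e2).
Proof. by case=> p [] q //=. Qed.

Let left_side : pred (T1 + T2)%type :=
  fun p => if p is inl _ then true else false.

Let sym_e := sym_connect_sym sum_rel_sym.

Let closed_left : closed (sum_rel e1 e2) left_side.
Proof. by apply: (intro_closed sym_e); case=> p [] q. Qed.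

Let adj_left : rel_adjunction inl (sum_rel e1 e2) e1 left_side.
Proof.
apply: (strict_adjunction (sym_connect_sym sym1) closed_left) => //.
- by move=> p q [].
- by apply/subsetP; case=> // p _; apply: codom_f.
Qed.

Let adj_right : rel_adjunction inr (sum_rel e1 e2) e2 [predC left_side].
Proof.
apply: (strict_adjunction (sym_connect_sym sym2) (predC_closed closed_left)).
- by move=> p q [].
- by apply/subsetP; case=> // p _; apply: codom_f.
- by move=> p q.
Qed.

Lemma connect_sum_ll p q :
  connect (sum_rel e1 e2) (inl p) (inl q) = connect e1 p q.
Proof. by rewrite (rel_functor adj_left). Qed.

Lemma connect_sum_rr p q :
  connect (sum_rel e1 e2) (inr p) (inr q) = connect e2 p q.
Proof. by rewrite (rel_functor adj_right). Qed.

Lemma connect_sum_lr p q : connect (sum_rel e1 e2) (inl p) (inr q) = false.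
Proof. by apply/negP => /(closed_connect closed_left). Qed.

Lemma connect_sum_rl p q : connect (sum_rel e1 e2) (inr p) (inl q) = false.
Proof. by rewrite sym_e connect_sum_lr. Qed.

Lemma n_comp_sum :
  n_comp (sum_rel e1 e2) predT = n_comp e1 predT + n_comp e2 predT.
Proof.
rewrite (n_compC left_side); congr (_ + _).
  exact: (adjunction_n_comp _ sym_e (sym_connect_sym sym1) closed_left adj_left).
exact: (adjunction_n_comp _ sym_e (sym_connect_sym sym2)
         (predC_closed closed_left) adj_right).
Qed.

End SumRel.

(** Both sums of tangles join two endpoints of one tangle to two endpoints of
    the other; only the choice of the endpoints differs. *)
Definition glue (T1 T2 : finType) (e1 : rel T1) (e2 : rel T2)
    (a1 a2 : T1) (b1 b2 : T2) : rel (T1 + T2)%type :=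
  add_edge (add_edge (sum_rel e1 e2) (inl a1) (inr b1)) (inl a2) (inr b2).

Section Glue.

Variables (T1 T2 : finType) (e1 : rel T1) (e2 : rel T2).
Hypotheses (sym1 : symmetric e1) (sym2 : symmetric e2).
Variables (a1 a2 : T1) (b1 b2 : T2).

Let sym_sum := sum_rel_sym sym1 sym2.
Let sym_sum' := add_edge_sym (inl a1) (inr b1) sym_sum.

Let connE := (connect_add_edge (inl a2) (inr b2) sym_sum',
              connect_add_edge (inl a1) (inr b1) sym_sum,
              connect_sum_ll sym1 sym2, connect_sum_rr sym1 sym2,
              connect_sum_lr sym1 sym2, connect_sum_rl sym1 sym2).

Let simplb := (andbF, orbF, orFb, andFb).

Lemma glue_sym : symmetric (glue e1 e2 a1 a2 b1 b2).
Proof. exact: add_edge_sym sym_sum'. Qed.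

Lemma connect_glue_ll p q :
  connect (glue e1 e2 a1 a2 b1 b2) (inl p) (inl q) =
  [|| connect e1 p q,
      [&& connect e1 p a2, connect e2 b2 b1 & connect e1 a1 q]
    | [&& connect e1 p a1, connect e2 b1 b2 & connect e1 a2 q]].
Proof. by rewrite !connE !simplb -!andbA. Qed.

Lemma connect_glue_rr p q :
  connect (glue e1 e2 a1 a2 b1 b2) (inr p) (inr q) =
  [|| connect e2 p q,
      [&& connect e2 p b1, connect e1 a1 a2 & connect e2 b2 q]
    | [&& connect e2 p b2, connect e1 a2 a1 & connect e2 b1 q]].
Proof. by rewrite !connE !simplb -!andbA. Qed.

Lemma connect_glue_lr p q :
  connect (glue e1 e2 a1 a2 b1 b2) (inl p) (inr q) =
  connect e1 p a1 && connect e2 b1 q || connect e1 p a2 && connect e2 b2 q.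
Proof.
rewrite !connE !simplb; have sym_e2 := sym_connect_sym sym2.
case: (boolP (connect e2 b1 b2)) => [b12|]; last by rewrite !simplb.
rewrite (same_connect sym_e2 b12); case: (connect e2 b2 q); rewrite ?simplb //.
by do 4?case: (connect _ _ _); rewrite ?orbT ?simplb.
Qed.

(** The first edge always merges two components.  The second one does unless
    its ends are already connected through the first. *)
Lemma n_comp_glue :
  n_comp e1 predT + n_comp e2 predT =
  (n_comp (glue e1 e2 a1 a2 b1 b2) predT
    + ~~ (connect e1 a1 a2 && connect e2 b1 b2)).+1.
Proof.
rewrite -(n_comp_sum sym1 sym2).
rewrite (n_comp_add_edge (inl a1) (inr b1) sym_sum).
rewrite (n_comp_add_edge (inl a2) (inr b2) sym_sum').
by rewrite !connE !simplb (sym_connect_sym sym1 a2) addn1.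
Qed.

End Glue.

End Graphs.

(** * Circles of crossingless tangles *)

Section Curves.

Local Open Scope nat_scope.

Lemma curve_sym (T : tangle) : symmetric (@curve T).
Proof.
suff [ss sj] : symmetric (@strand T) /\ symmetric (@join T).
  by move=> p q; rewrite /curve ss sj.
elim: T => [||b|A [sA jA] B [sB jB]|A [sA jA] B [sB jB]].
1-3: by split=> -[p1 p2] [q1 q2] //=; rewrite (eq_sym p1) (eq_sym p2).
- by split=> [] [p|p] [q|q] /=; rewrite ?(sA p) ?(sB p) ?(jA p) ?(jB p).
- by split=> [] [p|p] [q|q] /=; rewrite ?(sA p) ?(sB p) ?(jA p) ?(jB p).
Qed.

Lemma sum_eqE (T1 T2 : eqType) :
  ((forall a b : T1, ((inl a : T1 + T2) == inl b) = (a == b))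
  * (forall a b : T2, ((inr a : T1 + T2) == inr b) = (a == b))
  * (forall a b, ((inl a : T1 + T2) == inr b) = false)
  * (forall a b, ((inr a : T1 + T2) == inl b) = false))%type.
Proof. by []. Qed.

Lemma curve_hsum (A B : tangle) :
  @curve (hsum A B) =2
    glue (@curve A) (@curve B) (at_corner A (true, false))
      (at_corner A (false, false)) (at_corner B (true, true))
      (at_corner B (false, true)).
Proof.
have gl p q : glued_h p q =
    (p == at_corner A (true, false)) && (q == at_corner B (true, true)) ||
    (p == at_corner A (false, false)) && (q == at_corner B (false, true)).
  by apply/existsP/orP => [[[] pq]|[] pq]; [left|right|exists true|exists false].
case=> p [] q; rewrite /curve /glue /add_edge /= ?gl !sum_eqE ?(andbF, orbF) //.
by rewrite !(andbC (q == _)).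
Qed.

Lemma curve_vsum (A B : tangle) :
  @curve (vsum A B) =2
    glue (@curve A) (@curve B) (at_corner A (false, true))
      (at_corner A (false, false)) (at_corner B (true, true))
      (at_corner B (true, false)).
Proof.
have gl p q : glued_v p q =
    (p == at_corner A (false, true)) && (q == at_corner B (true, true)) ||
    (p == at_corner A (false, false)) && (q == at_corner B (true, false)).
  by apply/existsP/orP => [[[] pq]|[] pq]; [left|right|exists true|exists false].
case=> p [] q; rewrite /curve /glue /add_edge /= ?gl !sum_eqE ?(andbF, orbF) //.
by rewrite !(andbC (q == _)).
Qed.

Lemma lcurve_den (T : tangle) :
  @lcurve (den T) =2
    add_edge (add_edge (@curve T)
        (at_corner T (true, true)) (at_corner T (false, true)))
      (at_corner T (true, false)) (at_corner T (false, false)).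
Proof.
move=> p q; rewrite /lcurve /curve /closure_arc /add_edge -!orbA.
congr [|| _, _ | _].
apply/existsP/idP => [[[[] []] /= /andP[-> ->]]|]; rewrite ?orbT //.
by case/or4P => pq; [exists (true, true)|exists (false, true)
                   |exists (true, false)|exists (false, false)].
Qed.

(** [boundary_type S true] says that S joins its endpoints like the tangle 0,
    and [boundary_type S false] that it does so like the tangle infinity. *)
Definition boundary_type (S : tangle) (h : bool) : Prop :=
  forall c d : corner,
    connect (@curve S) (at_corner S c) (at_corner S d) =
    if h then c.1 == d.1 else c.2 == d.2.

(** Exactly two components reach the boundary, and NW and SE belong to
    different ones for both types. *)
Lemma n_comp_closed_circles (S : tangle) (h : bool) :
  boundary_type S h -> n_comp (@curve S) predT = (closed_circles S).+2.
Proof.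
move=> Sh; have sym := sym_connect_sym (@curve_sym S).
rewrite /closed_circles.
set a := [pred p | _]; rewrite (n_compC a) -addn2; congr (_ + _).
pose x := at_corner S (true, true); pose y := at_corner S (false, false).
have -> : n_comp (@curve S) [predC a] =
          n_comp (@curve S) (closure (@curve S) (pred2 x y)).
  apply: eq_n_comp_r => p; rewrite !inE negbK.
  apply/existsP/idP => [[c pc]|/pred0Pn[z /andP[/= pz /pred2P[zx|zy]]]].
  - have : connect (@curve S) (at_corner S c) x ||
           connect (@curve S) (at_corner S c) y.
      by rewrite !Sh; case: h c {Sh pc} => [] [[] []].
    by case/orP => cx; apply/existsP; [exists x|exists y];
      rewrite !inE eqxx ?orbT andbT (connect_trans pc).
  - by exists (true, true); rewrite -[at_corner S _]zx.
  - by exists (false, false); rewrite -[at_corner S _]zy.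
by rewrite (n_comp_closure2 sym) Sh; case: (h).
Qed.

Lemma boundary_type_zero : boundary_type zero true.
Proof.
move=> c d /=; apply/idP/eqP => [/connectP[s]|].
  elim: s c => [|x s IHs] c /=; first by move=> _ ->.
  by move=> /andP[] /orP[]//= /andP[/eqP-> _] /IHs.
case: c d => [c1 c2] [d1 d2] /= ->; have [->//|cd] := eqVneq c2 d2.
by apply: connect1; rewrite /curve /= eqxx cd.
Qed.

Lemma boundary_type_infty : boundary_type infty false.
Proof.
move=> c d /=; apply/idP/eqP => [/connectP[s]|].
  elim: s c => [|x s IHs] c /=; first by move=> _ ->.
  by move=> /andP[] /orP[]//= /andP[_ /eqP->] /IHs.
case: c d => [c1 c2] [d1 d2] /= ->; have [->//|cd] := eqVneq c1 d1.
by apply: connect1; rewrite /curve /= eqxx cd.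
Qed.

Lemma closed_circles0 (S : tangle) :
  (forall p, exists c, p = at_corner S c) -> closed_circles S = 0.
Proof.
move=> Sc; apply/eqP; rewrite -leqn0 leqNgt; apply/negP => /card_gt0P[p].
rewrite !inE => /andP[_ /existsP[]]; have [c pc] := Sc p; exists c.
by rewrite pc connect0.
Qed.

(** A new circle arises in a horizontal sum exactly when the right arc of A
    and the left arc of B are both vertical. *)
Lemma boundary_type_hsum (A B : tangle) (a b : bool) :
    boundary_type A a -> boundary_type B b ->
  boundary_type (hsum A B) (a && b) /\
  closed_circles (hsum A B) = closed_circles A + closed_circles B + ~~ (a || b).
Proof.
move=> Aa Bb; have sA := @curve_sym A; have sB := @curve_sym B.
have AB : boundary_type (hsum A B) (a && b).
  move=> c d; rewrite (eq_connect (@curve_hsum A B)).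
  (* By symmetry, the pair (right, left) is left out. *)
  wlog cd : c d / c.2 || ~~ d.2 => [H|].
    have [|] := boolP (c.2 || ~~ d.2); first exact: H.
    rewrite negb_or negbK => /andP[nc nd].
    rewrite (sym_connect_sym (glue_sym sA sB _ _ _ _)).
    by rewrite H ?nd // !(eq_sym c.1) !(eq_sym c.2).
  case: c d cd => [c1 []] [d1 []] //= _;
    rewrite ?(connect_glue_ll sA sB) ?(connect_glue_rr sA sB)
      ?(connect_glue_lr sA sB) ?Aa ?Bb //=;
    by case: a b c1 d1 {Aa Bb} => [] [] [] [].
split=> //; apply/eqP; rewrite -(eqn_add2r 4).
have := n_comp_glue sA sB (at_corner A (true, false))
      (at_corner A (false, false)) (at_corner B (true, true))
      (at_corner B (false, true)).
rewrite -(eq_n_comp (eq_connect (@curve_hsum A B))).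
rewrite (n_comp_closed_circles Aa) (n_comp_closed_circles Bb).
rewrite (n_comp_closed_circles AB) Aa Bb /=.
by case: a b {Aa Bb AB} => [] [] /=; lia.
Qed.

Lemma boundary_type_vsum (A B : tangle) (a b : bool) :
    boundary_type A a -> boundary_type B b ->
  boundary_type (vsum A B) (a || b) /\
  closed_circles (vsum A B) = closed_circles A + closed_circles B + (a && b).
Proof.
move=> Aa Bb; have sA := @curve_sym A; have sB := @curve_sym B.
have AB : boundary_type (vsum A B) (a || b).
  move=> c d; rewrite (eq_connect (@curve_vsum A B)).
  (* By symmetry, the pair (bottom, top) is left out. *)
  wlog cd : c d / c.1 || ~~ d.1 => [H|].
    have [|] := boolP (c.1 || ~~ d.1); first exact: H.
    rewrite negb_or negbK => /andP[nc nd].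
    rewrite (sym_connect_sym (glue_sym sA sB _ _ _ _)).
    by rewrite H ?nd // !(eq_sym c.1) !(eq_sym c.2).
  case: c d cd => [[] c2] [[] d2] //= _;
    rewrite ?(connect_glue_ll sA sB) ?(connect_glue_rr sA sB)
      ?(connect_glue_lr sA sB) ?Aa ?Bb //=;
    by case: a b c2 d2 {Aa Bb} => [] [] [] [].
split=> //; apply/eqP; rewrite -(eqn_add2r 4).
have := n_comp_glue sA sB (at_corner A (false, true))
      (at_corner A (false, false)) (at_corner B (true, true))
      (at_corner B (true, false)).
rewrite -(eq_n_comp (eq_connect (@curve_vsum A B))).
rewrite (n_comp_closed_circles Aa) (n_comp_closed_circles Bb).
rewrite (n_comp_closed_circles AB) Aa Bb /=.
by case: a b {Aa Bb AB} => [] [] /=; lia.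
Qed.

(** The two closing arcs turn the boundary arcs of 0 into one circle and those
    of infinity into two. *)
Lemma circles_den (S : tangle) (h : bool) :
  boundary_type S h -> circles (den S) = closed_circles S + (~~ h) + 1.
Proof.
move=> Sh; have sS := @curve_sym S.
pose e := add_edge (@curve S)
  (at_corner S (true, true)) (at_corner S (false, true)).
pose e' := add_edge e (at_corner S (true, false)) (at_corner S (false, false)).
have -> : circles (den S) = n_comp e' predT.
  exact: (eq_n_comp (eq_connect (@lcurve_den S))).
have := n_comp_add_edge (at_corner S (true, true))
  (at_corner S (false, true)) sS.
have := @n_comp_add_edge _ e (at_corner S (true, false))
  (at_corner S (false, false)) (add_edge_sym _ _ sS).
rewrite (n_comp_closed_circles Sh) connect_add_edge // !Sh -/e -/e'.
by case: h {Sh} => /=; lia.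
Qed.

End Curves.

(** * The bracket as a pair of coefficients *)

(* Sums over the states of a tangle are rewritten under the hypothesis that
   the index is a state, which needs a decidable membership. *)
Lemma tangle_comparable : comparable tangle.
Proof. by move=> A B; rewrite /decidable; do 2!decide equality. Qed.

HB.instance Definition _ := comparableMixin tangle_comparable.

Section Skein.

(** The coefficients at 0 and at infinity, computed by the two sums, at a point
    x of an arbitrary field.  The generality serves twice: a mirror image is
    the same computation at x^-1, and explicit identities are checked for an
    indeterminate element of an abstract field. *)
Fixpoint skein (K : fieldType) (x : K) (T : tangle) : K * K :=
  let d := - x ^ (-2) - x ^ 2 in
  match T with
  | zero => (1, 0)
  | infty => (0, 1)
  | cross b => if b then (x, x^-1) else (x^-1, x)
  | hsum A B =>
      let: (fA, gA) := skein x A in let: (fB, gB) := skein x B in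
      (fA * fB, fA * gB + gA * fB + d * (gA * gB))
  | vsum A B =>
      let: (fA, gA) := skein x A in let: (fB, gB) := skein x B in
      (gA * fB + fA * gB + d * (fA * fB), gA * gB)
  end.

Lemma skein_mirror (K : fieldType) (x : K) (T : tangle) :
  skein x (mirror T) = skein x^-1 T.
Proof.
have dV : - x ^ (-2) - x ^ 2 = - x^-1 ^ (-2) - x^-1 ^ 2.
  by rewrite !exprz_inv opprK addrC.
elim: T => [||[]|A IHA B IHB|A IHA B IHB] //=; rewrite ?invrK //.
- by rewrite IHA IHB dV.
- by rewrite IHA IHB dV.
Qed.

(* The value at a crossing is arbitrary, states having none. *)
Fixpoint hor (S : tangle) : bool :=
  match S with
  | hsum A B => hor A && hor B
  | vsum A B => hor A || hor B
  | infty => false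
  | _ => true
  end.

Lemma states_boundary_type (T : tangle) (s : int * tangle) :
  s \in states T -> boundary_type s.2 (hor s.2).
Proof.
elim: T s => [||b|A IHA B IHB|A IHA B IHB] s /=.
- rewrite inE => /eqP->; exact: boundary_type_zero.
- rewrite inE => /eqP->; exact: boundary_type_infty.
- rewrite !inE => /pred2P[->|->];
    [exact: boundary_type_zero|exact: boundary_type_infty].
- case/allpairsP=> -[x y] [/IHA xA /IHB yB ->].
  by case: (boundary_type_hsum xA yB).
- case/allpairsP=> -[x y] [/IHA xA /IHB yB ->].
  by case: (boundary_type_vsum xA yB).
Qed.

Definition weight (s : int * tangle) : ratfun :=
  t ^ s.1 * delta ^+ closed_circles s.2.

(** Filters are turned into zero weights, because the filter of a sum of two
    tangles mixes the indices of the two sums. *)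
Definition hweight s := if hor s.2 then weight s else 0.
Definition vweight s := if hor s.2 then 0 else weight s.

Lemma f_coef_hweight (T : tangle) : f_coef T = \sum_(s <- states T) hweight s.
Proof.
rewrite /f_coef big_mkcond; apply: eq_big_seq => s sT.
by rewrite (states_boundary_type sT) /hweight; case: (hor s.2).
Qed.

Lemma g_coef_vweight (T : tangle) : g_coef T = \sum_(s <- states T) vweight s.
Proof.
rewrite /g_coef big_mkcond; apply: eq_big_seq => s sT.
by rewrite (states_boundary_type sT) /vweight; case: (hor s.2).
Qed.

Lemma expfz_weight (K : fieldType) (x d : K) (a b : int) (m n k : nat) :
  x != 0 -> x ^ (a + b) * d ^+ (m + n + k) =
            (x ^ a * d ^+ m) * (x ^ b * d ^+ n) * d ^+ k.
Proof. by move=> x0; rewrite expfzDr // !exprD; ring. Qed.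

Lemma t_neq0 : t != 0.
Proof. by rewrite tofrac_eq0 polyX_eq0. Qed.

Lemma skein_coef (T : tangle) : skein t T = (f_coef T, g_coef T).
Proof.
rewrite f_coef_hweight g_coef_vweight.
have c0 : closed_circles zero = 0%N by apply: closed_circles0 => p; exists p.
have ci : closed_circles infty = 0%N by apply: closed_circles0 => p; exists p.
have simpl0 := (mulr1, mulr0, mul0r, addr0, add0r).
elim: T => [||b|A IHA B IHB|A IHA B IHB].
- by rewrite /= !big_seq1 /hweight /vweight /weight /= c0 mul1r.
- by rewrite /= !big_seq1 /hweight /vweight /weight /= ci mul1r.
- rewrite /= !big_cons !big_nil /hweight /vweight /weight /= c0 ci.
  by case: b; rewrite /= !simpl0.
- rewrite /= IHA IHB -/delta.
  have cc x y (xA : x \in states A) (yB : y \in states B) :=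
    (boundary_type_hsum (states_boundary_type xA) (states_boundary_type yB)).2.
  congr (_, _).
    rewrite big_allpairs_dep mulr_suml; apply: eq_big_seq => x xA.
    rewrite mulr_sumr; apply: eq_big_seq => y yB.
    rewrite /hweight /weight /= cc // (expfz_weight _ _ _ _ _ _ t_neq0).
    by case: (hor x.2); case: (hor y.2); rewrite /= ?simpl0.
  rewrite big_allpairs_dep !mulr_suml mulr_sumr -!big_split.
  apply: eq_big_seq => x xA /=; rewrite !mulr_sumr -!big_split.
  apply: eq_big_seq => y yB /=.
  rewrite /hweight /vweight /weight /= cc // (expfz_weight _ _ _ _ _ _ t_neq0).
  by case: (hor x.2); case: (hor y.2); rewrite /= ?simpl0 // mulrC.
- rewrite /= IHA IHB -/delta.
  have cc x y (xA : x \in states A) (yB : y \in states B) :=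
    (boundary_type_vsum (states_boundary_type xA) (states_boundary_type yB)).2.
  congr (_, _); last first.
    rewrite big_allpairs_dep mulr_suml; apply: eq_big_seq => x xA.
    rewrite mulr_sumr; apply: eq_big_seq => y yB.
    rewrite /vweight /weight /= cc // (expfz_weight _ _ _ _ _ _ t_neq0).
    by case: (hor x.2); case: (hor y.2); rewrite /= ?simpl0.
  rewrite big_allpairs_dep !mulr_suml mulr_sumr -!big_split.
  apply: eq_big_seq => x xA /=; rewrite !mulr_sumr -!big_split.
  apply: eq_big_seq => y yB /=.
  rewrite /hweight /vweight /weight /= cc // (expfz_weight _ _ _ _ _ _ t_neq0).
  by case: (hor x.2); case: (hor y.2); rewrite /= ?simpl0 // mulrC.
Qed.

Lemma bracket_den (T : tangle) : bracket (den T) = f_coef T + delta * g_coef T.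
Proof.
rewrite f_coef_hweight g_coef_vweight mulr_sumr -big_split.
apply: eq_big_seq => s sT /=.
rewrite (circles_den (states_boundary_type sT)) addn1 exprD.
rewrite /hweight /vweight /weight.
by case: (hor s.2) => /=; rewrite ?(mulr1, mulr0, addr0, add0r) // mulrA mulrC.
Qed.

End Skein.

(** * The tangles T10 and T20 *)

Section T10.

Lemma loop_valueE (K : fieldType) (x : K) :
  - x ^ (-2) - x ^ 2 = - (x ^+ 4 + 1) / x ^+ 2 :> K.
Proof.
have [->|x0] := eqVneq x 0.
  by rewrite !exp0rz /= !expr0n /= invr0 mulr0 subr0 oppr0.
by rewrite -exprnN -exprnP; field.
Qed.

Lemma skein_hsum (K : fieldType) (x : K) A B fA gA fB gB :
    skein x A = (fA, gA) -> skein x B = (fB, gB) ->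
  skein x (hsum A B) =
  (fA * fB, fA * gB + gA * fB - (x ^+ 4 + 1) / x ^+ 2 * (gA * gB)).
Proof. by move=> /= -> ->; rewrite loop_valueE !mulNr. Qed.

Lemma skein_vsum (K : fieldType) (x : K) A B fA gA fB gB :
    skein x A = (fA, gA) -> skein x B = (fB, gB) ->
  skein x (vsum A B) =
  (gA * fB + fA * gB - (x ^+ 4 + 1) / x ^+ 2 * (fA * fB), gA * gB).
Proof. by move=> /= -> ->; rewrite loop_valueE !mulNr. Qed.

Lemma skein_T10 (K : fieldType) (x : K) : x != 0 ->
  skein x T10 =
  ((x ^+ 28 - 2 * x ^+ 24 + 2 * x ^+ 20 - 2 * x ^+ 16 + 2 * x ^+ 8
      - 2 * x ^+ 4 + 2) / x ^+ 10,
   (x ^+ 24 - 3 * x ^+ 20 + 5 * x ^+ 16 - 7 * x ^+ 12 + 7 * x ^+ 8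
      - 5 * x ^+ 4 + 2) / x ^+ 8).
Proof.
move=> x0; pose one := cross true; pose two := hrep one 2.
have k1 : skein x one = (x, x^-1) by [].
have km1 : skein x (cross false) = (x^-1, x) by [].
have half : skein x (vrep one 2) = (1 - x ^+ 4, 1 / x ^+ 2).
  by rewrite (skein_vsum k1 k1); congr (_, _); field.
have k2 : skein x (hsum (vrep one 2) one) =
    (x - x ^+ 5, (- x ^+ 8 + x ^+ 4 - 1) / x ^+ 5).
  by rewrite (skein_hsum half k1); congr (_, _); field.
have ktwo : skein x two = (x ^+ 2, (x ^+ 4 - 1) / x ^+ 4).
  by rewrite (skein_hsum k1 k1); congr (_, _); field.
have k3 : skein x (vsum (hsum (vrep one 2) one) two) =
    ((x ^+ 12 - 2 * x ^+ 8 + 2 * x ^+ 4 - 2) / x ^+ 3,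
     (- x ^+ 12 + 2 * x ^+ 8 - 2 * x ^+ 4 + 1) / x ^+ 9).
  by rewrite (skein_vsum k2 ktwo); congr (_, _); field.
have km2 : skein x (hrep (cross false) 2) = (1 / x ^+ 2, 1 - x ^+ 4).
  by rewrite (skein_hsum km1 km1); congr (_, _); field.
have km3 : skein x (hrep (cross false) 3) =
    (1 / x ^+ 3, (x ^+ 8 - x ^+ 4 + 1) / x).
  by rewrite (skein_hsum km2 km1); congr (_, _); field.
have k4 : skein x
    (hsum (vsum (hsum (vrep one 2) one) two) (hrep (cross false) 3)) =
    ((x ^+ 12 - 2 * x ^+ 8 + 2 * x ^+ 4 - 2) / x ^+ 6,
     (x ^+ 20 - 2 * x ^+ 16 + 3 * x ^+ 12 - 4 * x ^+ 8 + 3 * x ^+ 4 - 2)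
       / x ^+ 4).
  by rewrite (skein_hsum k3 km3); congr (_, _); field.
by rewrite /T10 (skein_vsum k4 ktwo); congr (_, _); field.
Qed.

(** Modulo 2 the computation can be done by hand: f(T10) = t^18, and
    g(T10) = t^-4 + 1 + ... + t^16 is a geometric sum, which makes
    f + delta g = t^-6.  Both f and f + delta g are multiplicative for the
    horizontal sum, and mirroring replaces t by t^-1, so that both become 1
    at T20; hence delta g(T20), and then g(T20), is even. *)
Lemma skein_T20 (K : fieldType) (x : K) (u := x ^+ 4) : x != 0 ->
  skein x T20 =
  ((u ^+ 7 + 2 * (u ^+ 14 - 3 * u ^+ 13 + 5 * u ^+ 12 - 6 * u ^+ 11
      + 3 * u ^+ 10 + 3 * u ^+ 9 - 9 * u ^+ 8 + 12 * u ^+ 7 - 9 * u ^+ 6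
      + 3 * u ^+ 5 + 3 * u ^+ 4 - 6 * u ^+ 3 + 5 * u ^+ 2 - 3 * u + 1))
      / u ^+ 7,
   x ^+ 2 * (2 * (u ^+ 13 - 4 * u ^+ 12 + 9 * u ^+ 11 - 15 * u ^+ 10
      + 18 * u ^+ 9 - 15 * u ^+ 8 + 6 * u ^+ 7 + 6 * u ^+ 6 - 15 * u ^+ 5
      + 18 * u ^+ 4 - 15 * u ^+ 3 + 9 * u ^+ 2 - 4 * u + 1)) / u ^+ 7).
Proof.
move=> x0; have xV0 : x^-1 != 0 by rewrite invr_eq0.
have mT := etrans (skein_mirror x T10) (skein_T10 xV0).
rewrite /T20 (skein_hsum (skein_T10 x0) mT) /u.
by congr (_, _); field; rewrite x0 oner_eq0.
Qed.

End T10.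

(** * Evaluation of integer polynomials and substitution of t^-1 *)

Section Evaluation.

Variable K : fieldType.
Implicit Types (v : K) (p q : {poly int}).

Definition evalz v p : K := (map_poly intr p).[v].

Lemma evalzD v p q : evalz v (p + q) = evalz v p + evalz v q.
Proof. by rewrite /evalz rmorphD hornerD. Qed.

Lemma evalzB v p q : evalz v (p - q) = evalz v p - evalz v q.
Proof. by rewrite /evalz rmorphB hornerD hornerN. Qed.

Lemma evalzM v p q : evalz v (p * q) = evalz v p * evalz v q.
Proof. by rewrite /evalz rmorphM hornerM. Qed.

Lemma evalzZ v c p : evalz v (c *: p) = c%:~R * evalz v p.
Proof. by rewrite /evalz map_polyZ hornerZ. Qed.

Lemma evalzC v c : evalz v c%:P = c%:~R.
Proof. by rewrite /evalz map_polyC hornerC. Qed.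

Lemma evalz_nat v (m : nat) : evalz v m%:R = m%:R.
Proof. by rewrite /evalz rmorph_nat -polyC_natr hornerC. Qed.

Lemma evalz1 v : evalz v 1 = 1.
Proof. exact: evalz_nat 1. Qed.

Lemma evalz_exp2 v (r : nat) : evalz v (2 ^+ r) = 2 ^+ r.
Proof. by rewrite -!natrX evalz_nat. Qed.

Lemma evalzX v : evalz v 'X = v.
Proof. by rewrite /evalz map_polyX hornerX. Qed.

Lemma evalzXn v n : evalz v 'X^n = v ^+ n.
Proof. by rewrite /evalz map_polyXn hornerXn. Qed.

Lemma evalz_Poly v (s : seq int) :
  evalz v (Poly s) = foldr (fun c a => a * v + c%:~R) 0 s.
Proof.
elim: s => [|c s IHs] /=; first by rewrite /evalz rmorph0 horner0.
by rewrite cons_poly_def evalzD evalzM evalzX evalzC IHs.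
Qed.

Lemma evalz_comp v p q : evalz v (p \Po q) = evalz (evalz v q) p.
Proof. by rewrite /evalz map_comp_poly horner_comp. Qed.

(** The polynomial q is p with its coefficients reversed.  The bound on its
    size keeps the induction going: the new coefficient is placed above all
    the others. *)
Lemma evalzV v p : v != 0 ->
  exists q n, [/\ (size q <= n.+1)%N, q == 0 -> p == 0
                & evalz v^-1 p = evalz v q / v ^+ n].
Proof.
move=> v0; elim/poly_ind: p => [|p c [q [n [sq q0 IH]]]].
  by exists 0, 0%N; split; rewrite ?size_poly0 // /evalz !rmorph0 !horner0 mul0r.
exists (q + c *: 'X^(n.+1)), n.+1; split.
- apply: leq_trans (size_polyD _ _) _; rewrite geq_max (leq_trans sq) //=.
  by apply: leq_trans (size_scale_leq _ _) _; rewrite size_polyXn.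
- have [->|c0] := eqVneq c 0.
    by rewrite scale0r !addr0 => /q0/eqP->; rewrite mul0r.
  by rewrite -size_poly_eq0 addrC size_polyDl size_scale // size_polyXn.
- rewrite !evalzD evalzM evalzX evalzC IH evalzZ evalzXn exprS.
  by field; rewrite expf_neq0.
Qed.

End Evaluation.

Lemma evalz_t (p : {poly int}) : evalz t p = FracField.tofrac p.
Proof.
elim/poly_ind: p => [|p c IH]; first by rewrite tofrac0 /evalz rmorph0 horner0.
rewrite evalzD evalzM evalzX evalzC IH tofracD tofracM; congr (_ + _).
by rewrite -[in RHS](intz c) !rmorph_int.
Qed.

Lemma evalz_tV_neq0 (p : {poly int}) : p != 0 -> evalz t^-1 p != 0.
Proof.
have [q [n [_ q0 ->]]] := evalzV p t_neq0.
apply: contraNneq => /eqP.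
rewrite mulf_eq0 invr_eq0 expf_eq0 (negPf t_neq0) andbF orbF.
by rewrite evalz_t tofrac_eq0.
Qed.

Lemma frac_repr (h : ratfun) :
  h * FracField.tofrac (frac (repr h)).2 = FracField.tofrac (frac (repr h)).1.
Proof.
set x := repr h; rewrite -[h]reprK -/x; unlock FracField.tofrac.
rewrite -[LHS]FracField.pi_mul; apply/eqmodP.
rewrite /= FracField.equivfE /FracField.mulf.
by rewrite !numden_Ratio ?mulr1 ?oner_neq0 ?denom_ratioP // mulrC.
Qed.

(** As t^-1 is transcendental, no denominator vanishes there, so that any
    fraction representing h may be used instead of the chosen one. *)
Lemma subst_tV (a b : {poly int}) : b != 0 ->
  subst t^-1 (evalz t a / evalz t b) = evalz t^-1 a / evalz t^-1 b.
Proof.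
move=> b0; rewrite !evalz_t; set h := _ / _.
have := frac_repr h; have d0 := denom_ratioP (repr h).
have tb0 : FracField.tofrac b != 0 by rewrite tofrac_eq0.
rewrite /subst -/(evalz _ _) -/(evalz _ _).
move: (frac _).1 (frac _).2 d0 => n d d0.
move/(congr1 (fun z => z * FracField.tofrac b)); rewrite mulrAC divfK //.
rewrite -!tofracM => /eqP; rewrite tofrac_eq => /eqP adnb.
apply/eqP; rewrite eqr_div ?evalz_tV_neq0 //.
by rewrite -!evalzM adnb.
Qed.

Lemma laurent_evalzV (v : ratfun) (p : {poly int}) (m : nat) :
  v != 0 -> laurent v (evalz v^-1 p * v ^+ m).
Proof.
move=> v0; have [q [n [_ _ ->]]] := evalzV p v0.
by exists (q * 'X^m), n; rewrite -/(evalz _ _) evalzM evalzXn mulrAC.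
Qed.

Lemma leading_term_evalz (p : {poly int}) (m : nat) : p != 0 ->
  leading_term (evalz (t ^+ 4) p / (t ^+ 4) ^+ m)
    ((lead_coef p)%:~R * t ^ (((size p).-1 * 4)%N%:Z - (4 * m)%N%:Z)).
Proof.
move=> p0; exists (p \Po 'X^4), (4 * m)%N.
have l4 : lead_coef (p \Po 'X^4) = lead_coef p.
  by rewrite lead_coef_comp ?size_polyXn // lead_coefXn expr1n mulr1.
split.
- by rewrite -lead_coef_eq0 l4 lead_coef_eq0.
- by rewrite -evalz_t evalz_comp evalzXn exprM.
- by rewrite l4 size_comp_poly size_polyXn.
Qed.

(** * The coefficients of the tangles M_r *)

(** For f = p(u) / u^n and g = t^2 q(u) / u^n with u = t^4, this says that
    f = 1 and g = 0 modulo 2^r, and that the degree in t of g is at most that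
    of f minus 2. *)
Definition skein_invariant (r n : nat) (p q : {poly int}) : Prop :=
  [/\ exists a, p = 'X^n + 2 ^+ r * a, exists b, q = 2 ^+ r * b
     & (size q < size p)%N].

Lemma double_congr (R : comNzRingType) (x a b c w : R) :
  ((x + 2 * c * a) * (x + 2 * c * a) = x * x + 4 * c * (x * a + c * (a * a))) *
  (2 * c * b * (2 * (x + 2 * c * a) - w * (2 * c * b)) =
    4 * c * (b * (x + 2 * c * a - w * (c * b)))).
Proof. by split; ring. Qed.

(** The square of 1 + 2^r a is 1 modulo 2^(r+1) because r > 0, and the factor
    2 p - (1 + u) q of the new q is even for the same reason. *)
Lemma skein_invariant_double (r n : nat) (p q : {poly int}) :
  (0 < r)%N -> skein_invariant r n p q ->
  skein_invariant r.+1 (n + n) (p * p) (q * (2 * p - (1 + 'X) * q)).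
Proof.
move=> r0 [[a pE] [b qE] sqp].
pose c : {poly int} := 2 ^+ r.-1.
have rE : 2 ^+ r = 2 * c by rewrite -exprS prednK.
have rSE : 2 ^+ r.+1 = 4 * c by rewrite exprS rE mulrA -natrM.
split.
- exists ('X^n * a + c * (a * a)).
  by rewrite pE rSE rE exprD double_congr.
- exists (b * (p - (1 + 'X) * (c * b))).
  by rewrite pE qE rSE rE double_congr.
- pose w := 2 * p - (1 + 'X) * q; rewrite -/w.
  have p0 : p != 0 by rewrite -size_poly_gt0; apply: leq_ltn_trans sqp.
  have s1 : (size w <= size p)%N.
    apply: leq_trans (size_polyD _ _) _; rewrite size_polyN geq_max.
    apply/andP; split.
      by rewrite -polyC_natr mul_polyC size_scale_leq.
    apply: leq_trans (size_polyMleq _ _) _.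
    by rewrite addrC -polyC1 size_XaddC.
  rewrite (size_mul p0 p0); apply: leq_ltn_trans (size_polyMleq _ _) _.
  by move: s1 sqp; move: (size w) (size q) (size p) => i j k; lia.
Qed.

Lemma skein_M (K : fieldType) (x : K) (r : nat) : x != 0 -> (0 < r)%N ->
  exists p q n, skein_invariant r n p q /\
    skein x (M r) = (evalz (x ^+ 4) p / (x ^+ 4) ^+ n,
                     x ^+ 2 * (evalz (x ^+ 4) q / (x ^+ 4) ^+ n)).
Proof.
move=> x0; case: r => // r _; elim: r => [|r [p [q [n [pq IH]]]]].
  pose a : {poly int} :=
    Poly [:: 1; -3; 5; -6; 3; 3; -9; 12; -9; 3; 3; -6; 5; -3; 1].
  pose b : {poly int} :=
    Poly [:: 1; -4; 9; -15; 18; -15; 6; 6; -15; 18; -15; 9; -4; 1].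
  have sa : size (2 * a) = 15%N.
    by rewrite -polyC_natr mul_polyC size_scale // (@PolyK _ 0).
  have sb : size (2 * b) = 14%N.
    by rewrite -polyC_natr mul_polyC size_scale // (@PolyK _ 0).
  exists ('X^7 + 2 * a), (2 * b), 7%N; split.
    split; [by exists a|by exists b|].
    by rewrite addrC size_polyDl ?sa ?sb // size_polyXn.
  rewrite evalzD evalzXn !evalzM !evalz_nat !evalz_Poly /=.
  rewrite [LHS](skein_T20 x0).
  by congr (_, _); field.
exists (p * p), (q * (2 * p - (1 + 'X) * q)), (n + n)%N.
split; first exact: skein_invariant_double.
rewrite [LHS](skein_hsum IH IH).
rewrite !(evalzM, evalzB, evalzD) evalzX !evalz1 exprD.
by congr (_, _); field; rewrite ?x0 !expf_neq0.
Qed.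

(** * The writhe *)

Section Writhe.

(** Directions at NW, NE, then SW, SE, and the contribution to the writhe. *)
Definition profile : eqType := (bool * bool * (bool * bool) * int)%type.

Definition hmatch (xy : profile * profile) : bool :=
  let: ((_, ne, (_, se), _), (nw, _, (sw, _), _)) := xy in
  (ne != nw) && (se != sw).
Definition hmerge (xy : profile * profile) : profile :=
  let: ((nw, _, (sw, _), v), (_, ne, (_, se), w)) := xy in
  (nw, ne, (sw, se), v + w).
Definition vmatch (xy : profile * profile) : bool :=
  let: ((_, _, (sw, se), _), (nw, ne, _, _)) := xy in
  (sw != nw) && (se != ne).
Definition vmerge (xy : profile * profile) : profile :=
  let: ((nw, ne, _, v), (_, _, (sw, se), w)) := xy in
  (nw, ne, (sw, se), v + w).

Definition hglue (L1 L2 : seq profile) : seq profile :=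
  [seq hmerge xy | xy <- [seq (x, y) | x <- L1, y <- L2] & hmatch xy].
Definition vglue (L1 L2 : seq profile) : seq profile :=
  [seq vmerge xy | xy <- [seq (x, y) | x <- L1, y <- L2] & vmatch xy].

Fixpoint profiles (T : tangle) : seq profile :=
  let bits := [:: true; false] in
  match T with
  | zero => [seq (x, ~~ x, (y, ~~ y), 0) | x <- bits, y <- bits]
  | infty => [seq (x, y, (~~ x, ~~ y), 0) | x <- bits, y <- bits]
  | cross b => [seq (x, y, (~~ y, ~~ x), if (x == ~~ y) == b then 1 else -1)
               | x <- bits, y <- bits]
  | hsum A B => hglue (profiles A) (profiles B)
  | vsum A B => vglue (profiles A) (profiles B)
  end.

Definition profile_of (T : tangle) (o : point T -> bool) : profile :=
  (o (at_corner T (true, true)), o (at_corner T (true, false)),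
   (o (at_corner T (false, true)), o (at_corner T (false, false))),
   writhe_rec o).

Definition directed (T : tangle) (o : point T -> bool) : Prop :=
  forall p q, curve p q -> o p != o q.

Lemma profile_hsum (A B : tangle) (LA LB : seq profile) :
    (forall o : point A -> bool, directed o -> profile_of o \in LA) ->
    (forall o : point B -> bool, directed o -> profile_of o \in LB) ->
  forall o : point (hsum A B) -> bool,
    directed o -> profile_of o \in hglue LA LB.
Proof.
move=> IHA IHB o oP; apply/mapP.
exists (@profile_of A (o \o inl), @profile_of B (o \o inr)) => //.
rewrite mem_filter; apply/andP; split.
  by apply/andP; split; apply: oP; apply/orP; right; apply/existsP;
    [exists true|exists false]; rewrite !eqxx.
by apply: allpairs_f; [apply: IHA|apply: IHB] => p q pq; apply: oP.
Qed.

Lemma profile_vsum (A B : tangle) (LA LB : seq profile) :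
    (forall o : point A -> bool, directed o -> profile_of o \in LA) ->
    (forall o : point B -> bool, directed o -> profile_of o \in LB) ->
  forall o : point (vsum A B) -> bool,
    directed o -> profile_of o \in vglue LA LB.
Proof.
move=> IHA IHB o oP; apply/mapP.
exists (@profile_of A (o \o inl), @profile_of B (o \o inr)) => //.
rewrite mem_filter; apply/andP; split.
  by apply/andP; split; apply: oP; apply/orP; right; apply/existsP;
    [exists true|exists false]; rewrite !eqxx.
by apply: allpairs_f; [apply: IHA|apply: IHB] => p q pq; apply: oP.
Qed.

Lemma profile_of_profiles (T : tangle) (o : point T -> bool) :
  directed o -> profile_of o \in profiles T.
Proof.
elim: T o => [||b|A IHA B IHB|A IHA B IHB] o oP.
- have := oP (true, true) (true, false) isT.
  have := oP (false, true) (false, false) isT; rewrite /profile_of /=.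
  by case: (o _) (o _) (o _) (o _) => [] [] [] [].
- have := oP (true, true) (false, true) isT.
  have := oP (true, false) (false, false) isT; rewrite /profile_of /=.
  by case: (o _) (o _) (o _) (o _) => [] [] [] [].
- have := oP (true, true) (false, false) isT.
  have := oP (true, false) (false, true) isT; rewrite /profile_of /=.
  by case: (o _) (o _) (o _) (o _) => [] [] [] [] //= _ _; case: (b).
- exact: profile_hsum IHA IHB _ oP.
- exact: profile_vsum IHA IHB _ oP.
Qed.

(** For T20 this is a finite computation.  It is inherited by the sums of M_r
    with itself because the directions and the writhe of 0 + 0 are those
    of 0. *)
Lemma profile_M (r : nat) (o : point (M r) -> bool) :
  directed o -> profile_of o \in profiles zero.
Proof.
have subT20 : {subset profiles T20 <= profiles zero}.
  by apply/allP; vm_compute.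
have sub00 : {subset hglue (profiles zero) (profiles zero) <= profiles zero}.
  by apply/allP; vm_compute.
case: r o => [|r] o oP; first exact: subT20 (profile_of_profiles oP).
elim: r o oP => [|r IHr] o oP; first exact: subT20 (profile_of_profiles oP).
exact: sub00 (profile_hsum IHr IHr oP).
Qed.

Lemma writhe_K (r : nat) (o : lpoint (K r) -> bool) :
  orientation o -> writhe o = 1.
Proof.
move=> oP; have o_dir : @directed (vsum (cross true) (M r)) o.
  by move=> p q pq; apply: oP; rewrite /lcurve pq.
(* The closing arcs join NW to SW and NE to SE. *)
pose ok (e : profile) := let: (nw, ne, (sw, se), w) := e in
  (nw != sw) && (ne != se) ==> (w == 1).
have : all ok (vglue (profiles (cross true)) (profiles zero)) by vm_compute.
move=> /allP/(_ _ (profile_vsum (@profile_of_profiles _) (@profile_M r) o_dir)).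
rewrite /ok /profile_of => /implyP okK; apply/eqP/okK.
apply/andP; split; apply: oP; apply/orP; right; apply/existsP.
  by exists (true, true); rewrite !eqxx.
by exists (true, false); rewrite !eqxx.
Qed.

End Writhe.

(** * The Jones polynomial of K_r *)

(* The factor (- x^3)^-1 is the normalization for writhe 1. *)
Lemma den_skein (K : fieldType) (x f g : K) (T : tangle) :
    x != 0 -> skein x T = (f, g) ->
  let: (f', g') := skein x (vsum (cross true) T) in
  (- x ^+ 3)^-1 * (f' + (- x ^ (-2) - x ^ 2) * g') = f + g / x ^+ 6.
Proof.
move=> x0 Tfg.
have k1 : skein x (cross true) = (x, x^-1) by [].
rewrite (skein_vsum k1 Tfg) loop_valueE.
by field; rewrite oppr_eq0 expf_neq0 x0.
Qed.

Lemma chi_K (r : nat) (o : lpoint (K r) -> bool) : orientation o ->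
  chi o = f_coef (M r) + g_coef (M r) / t ^+ 6.
Proof.
move=> oP; have := den_skein t_neq0 (skein_coef (M r)).
by rewrite skein_coef /chi (writhe_K oP) /K bracket_den.
Qed.

Lemma add_div_t6 (K : fieldType) (x a b : K) (n : nat) : x != 0 ->
  a / (x ^+ 4) ^+ n + x ^+ 2 * (b / (x ^+ 4) ^+ n) / x ^+ 6 =
  (x ^+ 4 * a + b) / (x ^+ 4) ^+ n.+1.
Proof.
by move=> x0; rewrite [_ ^+ n.+1]exprS; field; rewrite x0 !expf_neq0.
Qed.

Theorem proposition5p2 (r : nat) (hr : (1 <= r)%N)
    (o : lpoint (K r) -> bool) (ho : orientation o) :
  laurent_congr (t ^+ 4) (2 ^ r) (jones o) 1 /\
  exists l : ratfun, leading_term (f_coef (M r)) l /\ leading_term (chi o) l.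
Proof.
have t0 := t_neq0; have u0 : t ^+ 4 != 0 by rewrite expf_neq0.
have [p [q [n [[[a pE] [b qE] sqp]]]]] := skein_M t0 hr.
rewrite skein_coef => -[fE gE].
pose P := 'X * p + q.
have chiE : chi o = evalz (t ^+ 4) P / (t ^+ 4) ^+ n.+1.
  rewrite (chi_K ho) fE gE evalzD evalzM evalzX.
  exact: add_div_t6.
have p0 : p != 0 by rewrite -size_poly_gt0; apply: leq_ltn_trans sqp.
have sXp : size ('X * p) = (size p).+1 by rewrite mulrC size_mulX.
have sqXp : (size q < size ('X * p)%R)%N by rewrite sXp ltnW.
split; last first.
  exists ((lead_coef p)%:~R * t ^ (((size p).-1 * 4)%N%:Z - (4 * n)%N%:Z)).
  split; first by rewrite fE; apply: leading_term_evalz.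
  have -> : ((size p).-1 * 4)%N%:Z - (4 * n)%N%:Z =
            ((size P).-1 * 4)%N%:Z - (4 * n.+1)%N%:Z.
    rewrite size_polyDl // sXp /=; move: p0; rewrite -size_poly_gt0.
    by move: (size p) => k k0; lia.
  have -> : lead_coef p = lead_coef P.
    by rewrite lead_coefDl // lead_coefM lead_coefX mul1r.
  rewrite chiE; apply: leading_term_evalz.
  by rewrite -size_poly_gt0 size_polyDl // sXp.
have PE : P = 'X^(n.+1) + 2 ^+ r * ('X * a + b).
  by rewrite /P pE qE exprS; ring.
have jE : jones o = evalz (t ^+ 4)^-1 P * (t ^+ 4) ^+ n.+1.
  rewrite /jones chiE.
  have -> : evalz (t ^+ 4) P / (t ^+ 4) ^+ n.+1 =
            evalz t (P \Po 'X^4) / evalz t 'X^(4 * n.+1)%N.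
    by rewrite evalz_comp !evalzXn exprM.
  rewrite subst_tV ?monic_neq0 ?monicXn // evalz_comp !evalzXn exprM !exprVn.
  by rewrite invrK.
split.
- by rewrite jE; apply: laurent_evalzV.
- by exists 1, 0%N; rewrite -/(evalz _ _) evalz1 expr0 divr1.
- exists (evalz (t ^+ 4)^-1 ('X * a + b) * (t ^+ 4) ^+ n.+1).
    exact: laurent_evalzV.
  rewrite jE PE evalzD evalzXn evalzM evalz_exp2 natrX mulrDl exprVn.
  by rewrite (mulVf (expf_neq0 n.+1 u0)) (addrC 1) addrK mulrA.
Qed.
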